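(* Let $v(t,x)=\sum_{k=1}^Kv_k(t,x_{S_k})$ with $v_k\in C^1([t_0,T]\times X_{S_k})$, and suppose $\ell(t,x,u)=\sum_{k=1}^K\ell_k(t,x_{N_k},u_{M_k})$ and $f_{S_k}(t,x,u)=f_k(t,x_{N_k},u_{M_k})$ for every $k$. Put $s_k:=\ell_k+A_kv_k$. Suppose there exist functions (local supply-rate budgets) $\sigma_k(t,x_{N_k},u_{M_k})$ such that, for all $(t,x,u)\in Z$, $$s_k(t,x_{N_k},u_{M_k})\ge\sigma_k(t,x_{N_k},u_{M_k}),\quad k=1,\dots,K,\qquad\text{and}\qquad\sum_{k=1}^K\sigma_k(t,x_{N_k},u_{M_k})\ge0.$$ Then $s_v:=\ell+L_fv\ge0$ on $Z$. If, in addition, the terminal cost admits a decomposition $g(x)=\sum_{k=1}^Kg_k(x_{S_k})$ and $v_k(T,x_{S_k})\le g_k(x_{S_k})$ for all $x\in X$ and all $k$, then $v(T,x)\le g(x)$ for all $x\in X$, and hence $v$ is a globally feasible OM-dual certificate.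
   Context: Setting. $t_0<T$, $X\subseteq\mathbb R^n$, $U\subseteq\mathbb R^m$, $Z:=[t_0,T]\times X\times U$, dynamics $f:Z\to\mathbb R^n$, running cost $\ell:Z\to\mathbb R$, terminal cost $g:X\to\mathbb R$. For $v\in C^1([t_0,T]\times X)$, $(L_fv)(t,x,u):=\partial_tv(t,x)+\nabla_xv(t,x)^\top f(t,x,u)$. $v$ is a (globally feasible) OM-dual certificate if $\ell+L_fv\ge0$ on $Z$ and $v(T,\cdot)\le g$ on $X$. Index sets: $S_k\subseteq\{1,\dots,n\}$ ($k=1,\dots,K$), state neighborhoods $N_k\supseteq S_k$, $N_k\subseteq\{1,\dots,n\}$, and control index sets $M_k\subseteq\{1,\dots,m\}$. $x_S$ (resp. $u_M$, $f_S$) denotes the subvector of components indexed by $S$ (resp. $M$, $S$), and $X_S$ is the projection of $X$ onto the coordinates in $S$. The blockwise transport operator is $$(A_k\phi)(t,x_{N_k},u_{M_k}):=\partial_t\phi(t,x_{S_k})+\nabla_{x_{S_k}}\phi(t,x_{S_k})^\top f_k(t,x_{N_k},u_{M_k}),\qquad\phi\in C^1([t_0,T]\times X_{S_k}).$$ *)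

(* Defs.v *)
From HB Require Import structures.
From mathcomp Require Import all_boot all_order all_algebra.
From mathcomp Require Import all_classical all_reals all_analysis.
Set Implicit Arguments.
Unset Strict Implicit.
Unset Printing Implicit Defensive.
Import Order.TTheory GRing.Theory Num.Theory.
Import numFieldNormedType.Exports.
Local Open Scope classical_set_scope.
Local Open Scope ring_scope.

(* Every function on a subset of a Euclidean space is given by a total
   representative; all hypotheses and conclusions only constrain it on (or, for
   derivatives, near) the stated domain.

   An element of C^1(D), for an arbitrary D, is a function which is
   continuously differentiable on some open neighborhood of D, and its
   derivatives on D are those of this representative.  (When D is contained in
   the closure of its interior, they are determined by the values on D.) *)

Section C1.
Context (R : realType) (n : nat).
Implicit Types (v : R * 'rV[R]_n -> R) (D : set (R * 'rV[R]_n)).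

Definition partial_t v (z : R * 'rV[R]_n) : R := derive1 (fun s : R => v (s, z.2)) z.1.

Definition grad_x v (z : R * 'rV[R]_n) : 'rV[R]_n :=
  \row_i 'D_(delta_mx 0 i) (fun y : 'rV[R]_n => v (z.1, y)) z.2.

Definition C1_on D v : Prop :=
  exists O : set (R * 'rV[R]_n), [/\ open O, D `<=` O &
    forall z, O z ->
      [/\ differentiable v z, {for z, continuous (partial_t v)} &
          {for z, continuous (grad_x v)}]].

End C1.

Definition dotv (R : realType) (n : nat) (a b : 'rV[R]_n) : R :=
  \sum_i a 0 i * b 0 i.

Section OMDual.
Context (R : realType) (n m : nat) (t0 T : R).
Context (X : set 'rV[R]_n) (U : set 'rV[R]_m).

Definition time_state : set (R * 'rV[R]_n) := `[t0, T] `*` X.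

Definition domZ (t : R) (x : 'rV[R]_n) (u : 'rV[R]_m) : Prop :=
  [/\ t0 <= t <= T, X x & U u].

Definition Lf (f : R -> 'rV[R]_n -> 'rV[R]_m -> 'rV[R]_n)
    (v : R * 'rV[R]_n -> R) (t : R) (x : 'rV[R]_n) (u : 'rV[R]_m) : R :=
  partial_t v (t, x) + dotv (grad_x v (t, x)) (f t x u).

Definition OM_dual_certificate
    (f : R -> 'rV[R]_n -> 'rV[R]_m -> 'rV[R]_n)
    (l : R -> 'rV[R]_n -> 'rV[R]_m -> R) (g : 'rV[R]_n -> R)
    (v : R * 'rV[R]_n -> R) : Prop :=
  [/\ C1_on time_state v,
      (forall t x u, domZ t x u -> 0 <= l t x u + Lf f v t x u) &
      (forall x, X x -> v (T, x) <= g x)].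

End OMDual.

Section Blocks.
Context (R : realType).

(* The components are listed in increasing order of their indices. *)
Definition subvec (n : nat) (S : {set 'I_n}) (x : 'rV[R]_n) : 'rV[R]_#|S| :=
  \row_j x 0 (enum_val j).

(* For S \subset N, the vector x_S read off from x_N:
   resubvec hSN (subvec N x) = subvec S x. *)
Definition resubvec (n : nat) (S N : {set 'I_n}) (hSN : S \subset N)
    (y : 'rV[R]_#|N|) : 'rV[R]_#|S| :=
  \row_j y 0 (enum_rank_in (fintype.subsetP hSN _ (enum_valP j)) (enum_val j)).

Lemma resubvecK (n : nat) (S N : {set 'I_n}) (hSN : S \subset N)
    (x : 'rV[R]_n) : resubvec hSN (subvec N x) = subvec S x.
Proof.
apply/rowP => j; rewrite !mxE enum_rankK_in //.
exact: (fintype.subsetP hSN _ (enum_valP j)).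
Qed.

Definition proj_set (n : nat) (S : {set 'I_n}) (X : set 'rV[R]_n) :
    set 'rV[R]_#|S| := subvec S @` X.

Definition transport (n m : nat) (S N : {set 'I_n}) (M : {set 'I_m})
    (hSN : S \subset N)
    (fk : R -> 'rV[R]_#|N| -> 'rV[R]_#|M| -> 'rV[R]_#|S|)
    (phi : R * 'rV[R]_#|S| -> R)
    (t : R) (xN : 'rV[R]_#|N|) (uM : 'rV[R]_#|M|) : R :=
  partial_t phi (t, resubvec hSN xN)
  + dotv (grad_x phi (t, resubvec hSN xN)) (fk t xN uM).

End Blocks.

Arguments proj_set {R n} S X.

(* Main.v *)
(* Each [v_k] is lifted to the full state by composing it with the linear map
   [(t, x) |-> (t, x_{S_k})].  By the chain rule, the lifted gradient paired
   with [f] is the block gradient paired with [f_{S_k}], so [l + L_f v] is the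
   sum of the [s_k] and is bounded below by the sum of the budgets. *)

From HB Require Import structures.
Require Import Defs.
From mathcomp Require Import all_boot all_order all_algebra.
From mathcomp Require Import all_classical all_reals all_analysis.
Set Implicit Arguments.
Unset Strict Implicit.
Unset Printing Implicit Defensive.
Import Order.TTheory GRing.Theory Num.Theory.
Import numFieldNormedType.Exports.
Local Open Scope classical_set_scope.
Local Open Scope ring_scope.

(** The identity is assumed only near [z] because it will be a derivative formula, known only where
    the summands are differentiable. A property true near [z] also holds at [z], so both the value
    and the limit of [F] can be read off the sum. *)
Lemma continuous_near_sum (R : realType) (V : topologicalType)
    (W : normedModType R) (K : nat) (F : V -> W) (G : 'I_K -> V -> W) (z : V) :
  (\forall y \near z, F y = \sum_(k < K) G k y) ->
  (forall k, {for z, continuous (G k)}) -> {for z, continuous F}.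
Proof.
move=> eqF cG; rewrite /prop_for /continuous_at (nbhs_singleton eqF).
have : \sum_(k < K) G k y @[y --> z] --> \sum_(k < K) G k z.
  by apply: (@cvg_big _ _ +%R) => [|k _]; [exact: add_continuous|exact: cG].
by apply: cvg_trans; apply: near_eq_cvg; apply: filterS eqF => y ->.
Qed.

(** Balls of matrices are entrywise, and finitely many neighborhoods, one per entry, intersect in a
    neighborhood. *)
Lemma continuous_mx_at (R : realType) (V : topologicalType) (p q : nat)
    (F : V -> 'M[R]_(p, q)) (z : V) :
  (forall i j, {for z, continuous (fun y => F y i j)}) ->
  {for z, continuous F}.
Proof.
move=> hF; apply/cvg_ballP => e e0.
have h i j : \forall y \near z, ball (F z i j) e (F y i j).
  by move/cvg_ballP : (hF i j); apply.
near=> y; split => // i j; move: i j; near: y.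
by apply: filter_forall => i; apply: filter_forall => j; exact: h.
Unshelve. all: by end_near. Qed.

Lemma subvec_is_linear (R : realType) (n : nat) (S : {set 'I_n}) :
  linear (@subvec R n S).
Proof. by move=> a x y; apply/rowP => j; rewrite !mxE. Qed.

HB.instance Definition _ (R : realType) (n : nat) (S : {set 'I_n}) :=
  GRing.isLinear.Build R 'rV[R]_n 'rV[R]_#|S| _ (@subvec R n S)
    (@subvec_is_linear R n S).

Lemma subvec_continuous (R : realType) (n : nat) (S : {set 'I_n}) :
  continuous (@subvec R n S).
Proof.
move=> x; apply: continuous_mx_at => i j.
rewrite (_ : (fun y => _) = fun y : 'rV[R]_n => y 0 (enum_val j)).
  exact: coord_continuous.
by apply/funext => y; rewrite mxE.
Qed.

(** * Partial derivatives and the C1 class under finite sums *)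

Section Calculus.
Context (R : realType) (n : nat).
Implicit Types (v w : R * 'rV[R]_n -> R) (D : set (R * 'rV[R]_n)).

(** Expand [u] in the standard basis and use linearity of the differential. *)
Lemma deriveE_dotv (h : 'rV[R]_n -> R) (y u : 'rV[R]_n) :
  differentiable h y ->
  'D_u h y = dotv (\row_i 'D_(delta_mx 0 i) h y) u.
Proof.
move=> dh; rewrite deriveE // {1}(row_sum_delta u) linear_sum.
by apply: eq_bigr => i _; rewrite linearZ mxE deriveE // mulrC.
Qed.

Lemma differentiable_slice_x v t x :
  differentiable v (t, x) -> differentiable (fun y => v (t, y)) x.
Proof.
move=> dv; exact: (@differentiable_comp _ _ _ _ (fun y => (t, y)) v).
Qed.

Lemma differentiable_slice_t v t x :
  differentiable v (t, x) -> differentiable (fun s => v (s, x)) t.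
Proof.
move=> dv; exact: (@differentiable_comp _ _ _ _ (fun s => (s, x)) v).
Qed.

Lemma C1_on_differentiable D v z : C1_on D v -> D z -> differentiable v z.
Proof. by case=> O [_ DO hO] /DO /hO[]. Qed.

Lemma partial_t_sum (K : nat) (w : 'I_K -> R * 'rV[R]_n -> R) z :
  (forall k, differentiable (w k) z) ->
  partial_t (fun y => \sum_(k < K) w k y) z = \sum_(k < K) partial_t (w k) z.
Proof.
case: z => t x dw; rewrite /partial_t derive1E /=.
rewrite (_ : (fun s => _) = \sum_(k < K) (fun s => w k (s, x))); last first.
  by apply/funext => s; rewrite fct_sumE.
rewrite derive_sum => [|k]; last exact/diff_derivable/differentiable_slice_t.
by apply: eq_bigr => k _; rewrite derive1E.
Qed.

Lemma grad_x_sum (K : nat) (w : 'I_K -> R * 'rV[R]_n -> R) z :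
  (forall k, differentiable (w k) z) ->
  grad_x (fun y => \sum_(k < K) w k y) z = \sum_(k < K) grad_x (w k) z.
Proof.
case: z => t x dw; apply/rowP => i; rewrite mxE summxE /=.
rewrite (_ : (fun y => _) = \sum_(k < K) (fun y => w k (t, y))); last first.
  by apply/funext => s; rewrite fct_sumE.
rewrite derive_sum => [|k]; last exact/diff_derivable/differentiable_slice_x.
by apply: eq_bigr => k _; rewrite mxE.
Qed.

(** The intersection of the open neighborhoods chosen for the summands serves for the sum. *)
Lemma C1_on_sum D (K : nat) (w : 'I_K -> R * 'rV[R]_n -> R) :
  (forall k, C1_on D (w k)) -> C1_on D (fun y => \sum_(k < K) w k y).
Proof.
move=> /choice [V hV].
have opV k : open (V k) by case: (hV k).
have C1V k z : V k z -> [/\ differentiable (w k) z,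
    {for z, continuous (partial_t (w k))} & {for z, continuous (grad_x (w k))}].
  by case: (hV k) => _ _; apply.
pose V_all := [set z | forall k, V k z].
(* Finiteness of the index set enters here. The fact gives openness of [V_all], and later the
   validity of the sum formulas on a whole neighborhood of [z]. *)
have near_V z : V_all z -> \forall y \near z, V_all y.
  move=> Vz; have : forall k, \forall y \near z, V k y.
    by move=> k; exact: open_nbhs_nbhs.
  by move/filter_forall; apply: filterS.
exists V_all; split.
- by rewrite openE => z /near_V.
- by move=> z Dz k; case: (hV k) => _ DV _; exact: DV.
move=> z Vz; split.
- rewrite (_ : (fun y => _) = \sum_(k < K) w k).
    by apply: differentiable_sum => k; case: (C1V k z (Vz k)).
  by apply/funext => y; rewrite fct_sumE.
- apply: (continuous_near_sum (G := fun k => partial_t (w k))) => [|k].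
    near=> y; apply: partial_t_sum => k.
    by case: (C1V k y) => //; move: k; near: y; exact: near_V.
  by case: (C1V k z (Vz k)).
- apply: (continuous_near_sum (G := fun k => grad_x (w k))) => [|k].
    near=> y; apply: grad_x_sum => k.
    by case: (C1V k y) => //; move: k; near: y; exact: near_V.
  by case: (C1V k z (Vz k)).
Unshelve. all: by end_near. Qed.

End Calculus.

(** * Chain rule for lifting a block function to the full state *)

Section Lift.
Context (R : realType) (n : nat) (S : {set 'I_n}).
Implicit Types (phi : R * 'rV[R]_#|S| -> R).

Definition restrict_state (z : R * 'rV[R]_n) : R * 'rV[R]_#|S| :=
  (z.1, subvec S z.2).

Lemma restrict_state_is_linear : linear restrict_state.
Proof. by move=> a x y; rewrite /restrict_state /= linearP. Qed.

HB.instance Definition _ := GRing.isLinear.Build R (R * 'rV[R]_n)%type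
  (R * 'rV[R]_#|S|)%type _ restrict_state restrict_state_is_linear.

Lemma restrict_state_continuous : continuous restrict_state.
Proof.
move=> z; apply: (@cvg_pair _ _ _ (nbhs z) (nbhs z.1) (nbhs (subvec S z.2))
  _ _ _ fst (@subvec R n S \o snd)); first exact: cvg_fst.
apply: (@cvg_comp _ _ _ snd (@subvec R n S)); first exact: cvg_snd.
exact: subvec_continuous.
Qed.

(** The difference quotients already coincide, since [subvec S] sends [h *: u + x] to
    [h *: subvec S u + subvec S x]. *)
Lemma derive_lift phi t x (u : 'rV[R]_n) :
  'D_u (fun y => (phi \o restrict_state) (t, y)) x =
  'D_(subvec S u) (fun y => phi (t, y)) (subvec S x).
Proof.
rewrite /derive /comp /restrict_state /=.
by under eq_fun => h do rewrite subvec_is_linear.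
Qed.

Lemma differentiable_lift phi z : differentiable phi (restrict_state z) ->
  differentiable (phi \o restrict_state) z.
Proof.
move=> dphi; apply: (@differentiable_comp _ _ _ _ restrict_state phi) => //.
exact/linear_differentiable/restrict_state_continuous.
Qed.

(** Both pairings are directional derivatives, along [u] and along [subvec S u], so [derive_lift]
    identifies them. *)
Lemma dotv_grad_x_lift phi t x (u : 'rV[R]_n) :
  differentiable phi (restrict_state (t, x)) ->
  dotv (grad_x (phi \o restrict_state) (t, x)) u =
  dotv (grad_x phi (restrict_state (t, x))) (subvec S u).
Proof.
move=> dphi; rewrite -deriveE_dotv; last first.
  exact/differentiable_slice_x/differentiable_lift.
by rewrite derive_lift deriveE_dotv //; exact: differentiable_slice_x.
Qed.

(** Each entry becomes a combination of block gradient entries with coefficients independent of [z],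
    so continuity carries over. The vector [subvec S (delta_mx 0 i)] is a basis vector or zero
    according to whether [i] lies in [S], which avoids a case distinction. *)
Lemma grad_x_lift phi z i : differentiable phi (restrict_state z) ->
  grad_x (phi \o restrict_state) z 0 i =
  dotv (grad_x phi (restrict_state z)) (subvec S (delta_mx 0 i)).
Proof.
case: z => t x dphi; rewrite mxE derive_lift deriveE_dotv //.
exact: differentiable_slice_x.
Qed.

Lemma C1_on_lift (D : set (R * 'rV[R]_n)) (E : set (R * 'rV[R]_#|S|)) phi :
  (forall z, D z -> E (restrict_state z)) ->
  C1_on E phi -> C1_on D (phi \o restrict_state).
Proof.
move=> DE [V [opV EV C1V]]; exists (restrict_state @^-1` V).
have opV' : open (restrict_state @^-1` V).
  by apply: open_comp => // z _; exact: restrict_state_continuous.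
split => // [z /DE /EV //|z Vz].
have [dphi ct cg] := C1V _ Vz.
have cr : {for z, continuous restrict_state}.
  exact: restrict_state_continuous.
split; first exact: differentiable_lift.
(* Lifting leaves the time variable alone: [partial_t] of the lift is [partial_t phi] after
   [restrict_state] by conversion. *)
- exact: (continuous_comp cr ct).
- apply: continuous_mx_at => i j; rewrite (ord1 i).
  apply: (continuous_near_sum (G := fun k y =>
    grad_x phi (restrict_state y) 0 k * subvec S (delta_mx 0 j) 0 k)).
    near=> y; apply: grad_x_lift.
    suff /C1V[] : V (restrict_state y) by [].
    by near: y; exact: open_nbhs_nbhs.
  move=> k; apply: cvgMr_tmp.
  exact: (cvg_comp _ _ (continuous_comp cr cg) (@coord_continuous _ _ _ 0 k _)).
Unshelve. all: by end_near. Qed.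

End Lift.

Lemma dotv_suml (R : realType) (n K : nat) (a : 'I_K -> 'rV[R]_n)
    (b : 'rV[R]_n) :
  dotv (\sum_(k < K) a k) b = \sum_(k < K) dotv (a k) b.
Proof.
rewrite /dotv exchange_big; apply: eq_bigr => i _.
by rewrite summxE mulr_suml.
Qed.

Theorem theorem3 (R : realType) (n m K : nat) (t0 T : R) (ht : t0 < T)
    (X : set 'rV[R]_n) (U : set 'rV[R]_m)
    (f : R -> 'rV[R]_n -> 'rV[R]_m -> 'rV[R]_n)
    (l : R -> 'rV[R]_n -> 'rV[R]_m -> R) (g : 'rV[R]_n -> R)
    (S N : 'I_K -> {set 'I_n}) (M : 'I_K -> {set 'I_m})
    (hSN : forall k, S k \subset N k)
    (vk : forall k : 'I_K, R * 'rV[R]_#|S k| -> R)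
    (hvk : forall k, C1_on (time_state t0 T (proj_set (S k) X)) (vk k))
    (lk : forall k : 'I_K, R -> 'rV[R]_#|N k| -> 'rV[R]_#|M k| -> R)
    (hl : forall t x u, domZ t0 T X U t x u ->
       l t x u = \sum_(k < K) lk k t (subvec (N k) x) (subvec (M k) u))
    (fk : forall k : 'I_K,
       R -> 'rV[R]_#|N k| -> 'rV[R]_#|M k| -> 'rV[R]_#|S k|)
    (hf : forall k t x u, domZ t0 T X U t x u ->
       subvec (S k) (f t x u) = fk k t (subvec (N k) x) (subvec (M k) u))
    (sigma : forall k : 'I_K, R -> 'rV[R]_#|N k| -> 'rV[R]_#|M k| -> R) :
  let v := fun z : R * 'rV[R]_n =>
    \sum_(k < K) vk k (z.1, subvec (S k) z.2) in
  let s := fun (k : 'I_K) t xN uM =>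
    lk k t xN uM + transport (hSN k) (fk k) (vk k) t xN uM in
  (forall t x u, domZ t0 T X U t x u ->
     (forall k, sigma k t (subvec (N k) x) (subvec (M k) u)
                <= s k t (subvec (N k) x) (subvec (M k) u))
     /\ 0 <= \sum_(k < K) sigma k t (subvec (N k) x) (subvec (M k) u)) ->
  (forall t x u, domZ t0 T X U t x u -> 0 <= l t x u + Lf f v t x u)
  /\ (forall gk : forall k : 'I_K, 'rV[R]_#|S k| -> R,
       (forall x, X x -> g x = \sum_(k < K) gk k (subvec (S k) x)) ->
       (forall k x, X x -> vk k (T, subvec (S k) x) <= gk k (subvec (S k) x)) ->
       (forall x, X x -> v (T, x) <= g x)
       /\ OM_dual_certificate t0 T X U f l g v).
Proof.
move=> v s hs.
pose w k := vk k \o @restrict_state R n (S k).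
have C1w k : C1_on (time_state t0 T X) (w k).
  by apply: C1_on_lift (hvk k) => z [tz Xz]; split=> //=; exists z.2.
(* [v] is convertible to the pointwise sum of the lifts [w k]. *)
have C1v : C1_on (time_state t0 T X) v by exact: (C1_on_sum (w := w)).
have inc t x u : domZ t0 T X U t x u -> 0 <= l t x u + Lf f v t x u.
  (* By transitivity, it remains to bound the sum of the budgets by [l + Lf f v]. *)
  move=> Z; have [hsigma /le_trans->//] := hs t x u Z.
  have [tT Xx Uu] := Z.
  have Dtx : time_state t0 T X (t, x) by split=> //=; rewrite in_itv.
  have dw k : differentiable (w k) (t, x) := C1_on_differentiable (C1w k) Dtx.
  have dvk k : differentiable (vk k) (t, subvec (S k) x).
    apply: C1_on_differentiable (hvk k) _.
    by split; [case: Dtx|exists x].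
  rewrite /Lf (partial_t_sum dw) (grad_x_sum dw) dotv_suml hl // -!big_split /=.
  apply: ler_sum => k _; apply: le_trans (hsigma k) _.
  (* [resubvecK] evaluates the block derivatives at [subvec (S k) x], and [hf] turns [fk] into the
     block of [f]. The chain rule then matches the gradient terms, and the time derivatives agree by
     conversion. *)
  by rewrite /s /transport resubvecK -hf // dotv_grad_x_lift.
split=> // gk hg hvg.
have terminal x : X x -> v (T, x) <= g x.
  by move=> Xx; rewrite hg //; apply: ler_sum => k _; exact: hvg.
by split.
Qed.
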